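(* Let $(X,p,E)$ be a $p$-KB-space and let $Y\subseteq X$ be an order closed sublattice. Then $(Y,p|_Y,E)$ is also a $p$-KB-space.
   Context: All vector lattices are real and Archimedean. A net $(x_\alpha)$ in a vector lattice is order convergent to $x$ ($x_\alpha\xrightarrow{o}x$) if there is a net $(y_\beta)$ (possibly with a different index set) with $y_\beta\downarrow 0$ such that for each $\beta$ there is $\alpha_\beta$ with $|x_\alpha-x|\le y_\beta$ for all $\alpha\ge\alpha_\beta$. A sublattice $Y$ of $X$ is a vector subspace closed under the lattice operations of $X$; it is order closed if the order limit in $X$ of any net in $Y$ that is order convergent in $X$ belongs to $Y$. A lattice-normed vector lattice (LNVL) is a triple $(X,p,E)$, where $X$ and $E$ are vector lattices and $p:X\to E_+$ satisfies: $p(x)=0\Leftrightarrow x=0$; $p(\lambda x)=|\lambda|p(x)$; $p(x+y)\le p(x)+p(y)$; and $|x|\le|y|\Rightarrow p(x)\le p(y)$. A net $x_\alpha$ $p$-converges to $x$ if $p(x_\alpha-x)\xrightarrow{o}0$ in $E$. A subset $A\subseteq X$ is $p$-bounded if there is $e\in E$ with $p(a)\le e$ for all $a\in A$. An LNVL $(X,p,E)$ is a $p$-KB-space if every $p$-bounded increasing net in $X_+$ is $p$-convergent in $X$. *)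

(* Defs.v *)
From HB Require Import structures.
From mathcomp Require Import all_boot all_order all_algebra.
From mathcomp Require Import boolp classical_sets reals.

Set Implicit Arguments.
Unset Strict Implicit.
Unset Printing Implicit Defensive.

Import Order.TTheory GRing.Theory Num.Theory.
Local Open Scope ring_scope.
Local Open Scope classical_set_scope.

(* Archimedean vector lattices over R.  Order.Lattice cannot be joined with
   GRing.Zmodule here (the hierarchy already joins them, only in Num.RealDomain,
   where the order is total), so the suprema and infima of pairs are given by
   operations of the mixin, characterized by their universal properties. *)
HB.mixin Record isArchimedeanVectorLattice (R : realType) V
    of Num.POrderedZmodule V & GRing.Lmodule R V := {
  vjoin : V -> V -> V;
  vmeet : V -> V -> V;
  vjoin_le : forall x y z : V, (vjoin x y <= z) = (x <= z) && (y <= z);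
  le_vmeet : forall x y z : V, (z <= vmeet x y) = (z <= x) && (z <= y);
  vl_leD2r : forall z x y : V, x <= y -> x + z <= y + z;
  vl_scaler_ge0 : forall (a : R) (x : V), 0 <= a -> 0 <= x -> 0 <= a *: x;
  vl_archimedean : forall x y : V,
    0 <= x -> (forall n : nat, x *+ n <= y) -> x = 0
}.

#[short(type="vectorLatticeType")]
HB.structure Definition VectorLattice (R : realType) :=
  { V of Num.POrderedZmodule V & GRing.Lmodule R V
       & isArchimedeanVectorLattice R V }.

Definition vabs (R : realType) (V : vectorLatticeType R) (x : V) : V :=
  vjoin x (- x).

Record directedSet := DirectedSet {
  dset :> Type;
  dle : dset -> dset -> Prop;
  dle_refl : forall a, dle a a;
  dle_trans : forall b a c, dle a b -> dle b c -> dle a c;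
  dset_inhabited : inhabited dset;
  dle_directed : forall a b, exists c, dle a c /\ dle b c
}.

Section OrderConvergence.
Variables (R : realType) (V : vectorLatticeType R).

Definition increasing_net (A : directedSet) (x : A -> V) :=
  forall a b : A, dle a b -> x a <= x b.

Definition decreasing_net (A : directedSet) (x : A -> V) :=
  forall a b : A, dle a b -> x b <= x a.

Definition is_infimum (A : Type) (x : A -> V) (m : V) :=
  (forall a, m <= x a) /\ (forall z, (forall a, z <= x a) -> z <= m).

Definition decreases_to (A : directedSet) (x : A -> V) (m : V) :=
  decreasing_net x /\ is_infimum x m.

Definition order_cvg (A : directedSet) (x : A -> V) (l : V) :=
  exists (B : directedSet) (y : B -> V), decreases_to y 0 /\
    forall b : B, exists a0 : A, forall a : A,
      dle a0 a -> vabs (x a - l) <= y b.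

Definition sublattice (Y : set V) :=
  [/\ Y 0,
      forall x y, Y x -> Y y -> Y (x + y),
      forall (c : R) x, Y x -> Y (c *: x),
      forall x y, Y x -> Y y -> Y (vmeet x y)
    & forall x y, Y x -> Y y -> Y (vjoin x y)].

Definition order_closed (Y : set V) :=
  forall (A : directedSet) (x : A -> V) (l : V),
    (forall a, Y (x a)) -> order_cvg x l -> Y l.

End OrderConvergence.

(* A sublattice Y of V, as a vector lattice in its own right, for the
   operations and the order inherited from V. *)
Definition sublattice_type (R : realType) (V : vectorLatticeType R)
  (Y : set V) (hY : sublattice Y) : Type := {x : V | x \in Y}.

Section SublatticeType.
Variables (R : realType) (V : vectorLatticeType R) (Y : set V).
Hypothesis hY : sublattice Y.

Let Ypred : pred V := fun x => x \in Y.

Fact sublattice_submod_closed : submod_closed Ypred.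
Proof.
case: hY => Y0 YD YZ _ _; split; first exact: mem_set.
move=> c x y /set_mem Yx /set_mem Yy; apply: mem_set.
by apply: (YD) => //; apply: YZ.
Qed.

Local Notation T := (sublattice_type hY).

HB.instance Definition _ := SubType.copy T {x : V | Ypred x}.
HB.instance Definition _ := Choice.copy T {x : V | Ypred x}.
HB.instance Definition _ := GRing.SubChoice_isSubLmodule.Build R V Ypred T
  sublattice_submod_closed.
HB.instance Definition _ := Order.SubChoice_isSubPOrder.Build
  ring_display V Ypred ring_display T.

Fact sublattice_vmeet_subproof (x y : T) : vmeet (val x) (val y) \in Y.
Proof.
case: hY => _ _ _ YI _; apply: mem_set.
by apply: YI; apply: set_mem; exact: (valP _).
Qed.

Fact sublattice_vjoin_subproof (x y : T) : vjoin (val x) (val y) \in Y.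
Proof.
case: hY => _ _ _ _ YU; apply: mem_set.
by apply: YU; apply: set_mem; exact: (valP _).
Qed.

Definition sublattice_vmeet (x y : T) : T :=
  Sub (vmeet (val x) (val y)) (sublattice_vmeet_subproof x y).

Definition sublattice_vjoin (x y : T) : T :=
  Sub (vjoin (val x) (val y)) (sublattice_vjoin_subproof x y).

Fact sublattice_vjoin_le (x y z : T) :
  (sublattice_vjoin x y <= z) = (x <= z) && (y <= z).
Proof. by rewrite !leEsub SubK vjoin_le. Qed.

Fact sublattice_le_vmeet (x y z : T) :
  (z <= sublattice_vmeet x y) = (z <= x) && (z <= y).
Proof. by rewrite !leEsub SubK le_vmeet. Qed.

Fact sublattice_leD2r (z x y : T) : x <= y -> x + z <= y + z.
Proof. by move=> xy; rewrite leEsub !raddfD /=; exact: vl_leD2r. Qed.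

Fact sublattice_scaler_ge0 (a : R) (x : T) : 0 <= a -> 0 <= x -> 0 <= a *: x.
Proof.
move=> a0; rewrite !leEsub linearZ raddf0 => x0.
exact: vl_scaler_ge0.
Qed.

Fact sublattice_archimedean (x y : T) :
  0 <= x -> (forall n : nat, x *+ n <= y) -> x = 0.
Proof.
rewrite leEsub raddf0 => x0 xy; apply: val_inj; rewrite raddf0.
apply: (vl_archimedean (val x) (val y)) => // n.
by have := xy n; rewrite leEsub raddfMn.
Qed.

HB.instance Definition _ := isArchimedeanVectorLattice.Build R T
  sublattice_vjoin_le sublattice_le_vmeet sublattice_leD2r sublattice_scaler_ge0 sublattice_archimedean.

End SublatticeType.

Section LatticeNorm.
Variables (R : realType) (X E : vectorLatticeType R) (p : X -> E).

(* (X, p, E) is a lattice-normed vector lattice. *)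
Definition lattice_normed : Prop :=
  [/\ forall x, 0 <= p x,
      forall x, p x = 0 <-> x = 0,
      forall (c : R) x, p (c *: x) = `|c| *: p x,
      forall x y, p (x + y) <= p x + p y
    & forall x y, vabs x <= vabs y -> p x <= p y].

Definition p_cvg (A : directedSet) (x : A -> X) (l : X) :=
  order_cvg (fun a => p (x a - l)) 0.

Definition p_bounded (S : set X) := exists e : E, forall x, S x -> p x <= e.

Definition p_KB_space : Prop := lattice_normed /\
  forall (A : directedSet) (x : A -> X),
    (forall a, 0 <= x a) -> increasing_net x -> p_bounded (range x) ->
    exists l : X, p_cvg x l.

End LatticeNorm.

Definition norm_restr (R : realType) (X E : vectorLatticeType R) (p : X -> E)
  (Y : set X) (hY : sublattice Y) : sublattice_type hY -> E :=
  fun y => p (val y).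

Arguments norm_restr {R X E} p {Y} hY y.

(* Main.v *)
Require Import Defs.
From mathcomp Require Import all_boot all_order all_algebra.
From mathcomp Require Import boolp classical_sets reals.

(* The p-limit l in X of an increasing net of Y is its supremum in X: for an
   index b and an upper bound z of the net, both (x_b - l)^+ and (l - z)^+ lie
   eventually below |x_a - l|, so their p-norms lie below a net decreasing to 0.
   Hence the net is order convergent to l, and l belongs to Y. *)

Set Implicit Arguments.
Unset Strict Implicit.
Unset Printing Implicit Defensive.

Import Order.TTheory GRing.Theory Num.Theory.
Local Open Scope ring_scope.
Local Open Scope classical_set_scope.

Section VectorLatticeTheory.
Variables (R : realType) (V : vectorLatticeType R).
Implicit Types x y z : V.

Lemma vl_subr_ge0 x y : (0 <= y - x) = (x <= y).
Proof.
apply/idP/idP => [h|h]; first by have := vl_leD2r x _ _ h; rewrite add0r subrK.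
by have := vl_leD2r (- x) _ _ h; rewrite subrr.
Qed.

Lemma vl_subr_le0 x y : (x - y <= 0) = (x <= y).
Proof. by rewrite -[LHS]vl_subr_ge0 sub0r opprB vl_subr_ge0. Qed.

Lemma vl_le_subr x y z : (x <= y - z) = (z <= y - x).
Proof. by rewrite -[LHS]vl_subr_ge0 -[RHS]vl_subr_ge0 addrAC. Qed.

Lemma vl_lerNl x y : (- x <= y) = (- y <= x).
Proof. by rewrite -[LHS]vl_subr_ge0 -[RHS]vl_subr_ge0 !opprK addrC. Qed.

Lemma le_vabs x : x <= vabs x.
Proof. by have := lexx (vabs x); rewrite vjoin_le => /andP[]. Qed.

Lemma leN_vabs x : - x <= vabs x.
Proof. by have := lexx (vabs x); rewrite vjoin_le => /andP[]. Qed.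

(** From [- vabs x <= x <= vabs x] it follows that twice the modulus is nonnegative; scaling by
    [2^-1] removes the factor. *)
Lemma vabs_ge0 x : 0 <= vabs x.
Proof.
have Nle : - vabs x <= vabs x.
  by apply: le_trans (le_vabs x); rewrite vl_lerNl leN_vabs.
have h2 : 0 <= vabs x *+ 2 by rewrite mulr2n -{2}[vabs x]opprK vl_subr_ge0.
have half_ge0 : 0 <= 2^-1 :> R by rewrite invr_ge0 ler0n.
have := vl_scaler_ge0 _ _ half_ge0 h2.
by rewrite -scaler_nat scalerA mulVf ?scale1r // pnatr_eq0.
Qed.

Lemma ge0_vabs x : 0 <= x -> vabs x = x.
Proof.
move=> x0; apply/le_anti; rewrite le_vabs andbT vjoin_le lexx /=.
by apply: (le_trans _ x0); rewrite -sub0r vl_subr_le0.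
Qed.

(** The gaps [l - x a], indexed by [A] itself, serve as the dominating net. *)
Lemma increasing_sup_order_cvg (A : directedSet) (x : A -> V) (l : V) :
  increasing_net x -> (forall a, x a <= l) ->
  (forall z, (forall a, x a <= z) -> l <= z) -> order_cvg x l.
Proof.
move=> xincr xl lmin; exists A, (fun a => l - x a); split; last first.
  move=> b; exists b => a ba.
  rewrite vjoin_le opprB; apply/andP; split.
    by apply: (@le_trans _ _ 0); rewrite ?vl_subr_le0 ?vl_subr_ge0.
  by rewrite vl_le_subr subKr xincr.
split; first by move=> a b ab; rewrite vl_le_subr subKr xincr.
split=> [a|z zle]; first by rewrite vl_subr_ge0.
(* A lower bound [z] of the gaps makes [l - z] an upper bound of the net, so leastness of [l] forces
   [z <= 0]. *)
have : l <= l - z by apply: lmin => a; rewrite vl_le_subr.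
by rewrite vl_le_subr subrr.
Qed.

End VectorLatticeTheory.

Section PConvergence.
Variables (R : realType) (X E : vectorLatticeType R) (p : X -> E).
Hypothesis pP : lattice_normed p.

(** Each dominating [y b] needs only one index past its threshold at which [u] is below the modulus,
    so a cofinal bound suffices. Passing to the positive part [v] of [u] makes [p] monotone on the
    comparison. *)
Lemma p_cvg_frequently_le0 (A : directedSet) (x : A -> X) (l u : X) :
  p_cvg p x l ->
  (forall a0, exists2 a, dle a0 a & u <= vabs (x a - l)) -> u <= 0.
Proof.
case: pP => p_ge0 p_eq0 _ _ p_mono [B [y [[_ [_ ymin]] ycvg]]] ule.
pose v := vjoin u 0.
have /andP[uv v0] : (u <= v) && (0 <= v) by rewrite -vjoin_le.
suff pv : p v = 0 by move/p_eq0: pv => <-.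
apply/le_anti; rewrite p_ge0 andbT; apply: ymin => b.
have [a0 a0P] := ycvg b; have [a a0a ua] := ule a0.
apply: le_trans (a0P a a0a); rewrite subr0; apply: le_trans (le_vabs _).
by apply: p_mono; rewrite (ge0_vabs v0) vjoin_le ua vabs_ge0.
Qed.

Lemma increasing_p_cvg_order_cvg (A : directedSet) (x : A -> X) (l : X) :
  increasing_net x -> p_cvg p x l -> order_cvg x l.
Proof.
move=> xincr xl; apply: increasing_sup_order_cvg => //.
(* Upper bound: for [a] past both [a0] and [b], [x b - l <= x a - l]. *)
- move=> b; rewrite -vl_subr_le0; apply: (p_cvg_frequently_le0 xl) => a0.
  have [a [a0a ba]] := dle_directed a0 b; exists a => //.
  by apply: le_trans (le_vabs _); apply: vl_leD2r; apply: xincr.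
(* Leastness: [x a0 <= z] gives [l - z <= l - x a0], so [a0] itself will do. *)
- move=> z xz; rewrite -vl_subr_le0; apply: (p_cvg_frequently_le0 xl) => a0.
  exists a0; first exact: dle_refl.
  by apply: le_trans (leN_vabs _); rewrite opprB vl_le_subr subKr.
Qed.

Lemma lattice_normed_restr (Y : set X) (hY : sublattice Y) :
  lattice_normed (norm_restr p hY).
Proof.
case: pP => p_ge0 p_eq0 pZ pD p_mono; rewrite /norm_restr; split.
- by move=> x; apply: p_ge0.
- move=> x; split=> [/p_eq0 x0|->]; last by apply/p_eq0; rewrite raddf0.
  by apply: val_inj; rewrite raddf0.
- by move=> c x; rewrite linearZ pZ.
- by move=> x y; rewrite raddfD pD.
- move=> x y xy; apply: p_mono.
  (* The modulus of [Y] is the one of [X], as joins and opposites are inherited; monotonicity of [p]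
     then transfers. *)
  suff valE (z : sublattice_type hY) :
      vabs (val z) = val (vabs z : sublattice_type hY).
    by rewrite !valE -leEsub.
  by rewrite /vabs -raddfN.
Qed.

End PConvergence.

Theorem proposition2p14 (R : realType) (X E : vectorLatticeType R) (p : X -> E)
  (hX : p_KB_space p) (Y : set X) (hY : sublattice Y) (hYc : order_closed Y) :
  p_KB_space (norm_restr p hY).
Proof.
case: hX => pP KB; split; first exact: lattice_normed_restr.
move=> A x x0 xincr [e xe].
have vincr : increasing_net (fun a => val (x a)).
  by move=> a b ab; rewrite -leEsub xincr.
have [||l xl] := KB A (fun a => val (x a)) _ vincr.
- by move=> a; have := x0 a; rewrite leEsub raddf0.
- by exists e => _ [a _ <-]; apply: xe; exists a.
have Yl : Y l.
  apply: hYc (increasing_p_cvg_order_cvg pP vincr xl) => a.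
  exact: set_mem (valP (x a)).
exists (exist _ l (mem_set Yl) : sublattice_type hY).
rewrite /p_cvg /norm_restr.
(* Both convergences concern the same net of norms in [E], since [val] commutes with subtraction. *)
by under eq_fun do rewrite raddfB.
Qed.
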